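(* Let $\theta_1,\theta_2,\theta_3$ be three real-valued random variables on $\Omega$ such that for some $\delta>0$ it holds for $i=1,2$ and every $\omega\in\Omega$ that $$\theta_i(\omega')\le\theta_{i+1}(\omega)\quad\text{for all }\omega'\in\overline{O}^{\theta_{i+1}(\omega)}_\delta(\omega)=\{\omega'\in\Omega:\|\omega'-\omega\|_{0,\theta_{i+1}(\omega)}\le\delta\}.$$ If $\theta_2$ takes values in $(0,T]$, then for any $\kappa>T/\delta$ there exists an $\mathbf{F}$-stopping time $\wp$ such that $\theta_1\le\wp\le\theta_3$ on $\Omega$. Moreover, given $\omega_1,\omega_2\in\Omega$, $$|\wp(\omega_1)-\wp(\omega_2)|\le\kappa\|\omega_1-\omega_2\|_{0,t_0}$$ holds for every $t_0\in[b,T]\cup\{t\in[a,b):t\ge a+\kappa\|\omega_1-\omega_2\|_{0,t}\}$, where $a:=\wp(\omega_1)\wedge\wp(\omega_2)$ and $b:=\wp(\omega_1)\vee\wp(\omega_2)$.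
   Context: Fix $d\in\mathbb{N}$, $T\in(0,\infty)$. $\Omega=\{\omega\in C([0,T];\mathbb{R}^d):\omega(0)=0\}$, $\|\omega\|_{0,t}=\sup_{r\in[0,t]}|\omega(r)|$ for $t\in[0,T]$ (if $\theta_3(\omega)>T$, read $\|\cdot\|_{0,\theta_3(\omega)}$ as $\|\cdot\|_{0,T}$), $B$ is the canonical process on $\Omega$, $\mathcal{F}_t=\sigma(B_r:r\in[0,t])$, and $\mathbf{F}=\{\mathcal{F}_t\}_{t\in[0,T]}$ is the raw natural filtration. Stopping times are $[0,T]$-valued. *)

(* Defs.v *)
From HB Require Import structures.
From mathcomp Require Import all_boot all_order all_algebra.
From mathcomp Require Import all_classical all_reals all_analysis.

Set Implicit Arguments.
Unset Strict Implicit.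
Unset Printing Implicit Defensive.

Import Order.TTheory GRing.Theory Num.Theory.
Import numFieldNormedType.Exports.

Local Open Scope classical_set_scope.
Local Open Scope ring_scope.

(* The norm |.| of R^d; the library's norm on 'rV[R]_d is the max norm. *)
Definition euclid_norm (R : realType) (d : nat) (x : 'rV[R]_d) : R :=
  Num.sqrt (\sum_(i < d) x 0 i ^+ 2).

(* As a type, [0, T] carries the topology induced by R. *)
Notation time T := (set_type `[0, T]%classic).

Record path_space (R : realType) (d : nat) (T : R) := PathSpace {
  path_fun :> time T -> 'rV[R]_d ;
  path_continuous : continuous path_fun ;
  path_start : forall t : time T, \val t = 0 -> path_fun t = 0 }.

(* ||f||_(0,t) = sup_(r in [0, t]) |f r|; as r ranges over [0, T] only,
   any t > T counts as T. *)
Definition sup_norm (R : realType) (d : nat) (T : R)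
    (f : time T -> 'rV[R]_d) (t : R) : R :=
  sup [set euclid_norm (f r) | r in [set r : time T | \val r <= t]].

Definition path_dist (R : realType) (d : nat) (T : R)
    (w1 w2 : path_space d T) (t : R) : R :=
  sup_norm (fun r => w1 r - w2 r) t.

Definition closed_tube (R : realType) (d : nat) (T : R)
    (delta t : R) (w : path_space d T) : set (path_space d T) :=
  [set w' | path_dist w' w t <= delta].

Definition canonical_process (R : realType) (d : nat) (T : R)
    (r : time T) (w : path_space d T) : 'rV[R]_d := w r.

(* F_t = sigma(B_r : 0 <= r <= t), R^d being given its Borel sigma-algebra;
   neither augmented nor made right-continuous. *)
Definition natural_filtration (R : realType) (d : nat) (T : R) (t : R) :
    set (set (path_space d T)) :=
  <<s \bigcup_(r in [set r : time T | \val r <= t])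
        preimage_set_system setT (@canonical_process R d T r)
          <<s (open : set (set 'rV[R]_d)) >> >>.

(* The sigma-algebra on the path space is F_T, and R has its Borel sets. *)
Definition path_random_variable (R : realType) (d : nat) (T : R)
    (X : path_space d T -> R) : Prop :=
  forall A : set R, measurable A -> natural_filtration T (X @^-1` A).

Definition stopping_time (R : realType) (d : nat) (T : R)
    (tau : path_space d T -> R) : Prop :=
  (forall w, 0 <= tau w <= T) /\
  (forall t : R, 0 <= t <= T ->
     natural_filtration t [set w | tau w <= t]).

(* Main.v *)
Require Import Defs.
From mathcomp Require Import all_boot all_order all_algebra.
From mathcomp Require Import all_classical all_reals all_analysis.
From mathcomp Require Import ring lra.

(* Put [f v w := min T (theta2 v + kappa ||w - v||_(0, theta2 v))] and
   [p w := inf_v f v w].  Taking [v = w] gives [p w <= theta2 w <= theta3 w].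
   If [w] lies in the [delta]-tube of [v] up to [theta2 v], then
   [theta1 w <= theta2 v <= f v w]; otherwise [kappa delta > T] forces
   [f v w = T >= theta1 w].  Since [theta2 v <= f v w], an almost optimal [v]
   for [w1] only sees the paths up to slightly after [p w1], so right-continuity
   of [t |-> ||w1 - w2||_(0, t)] yields
   [p w2 <= p w1 + kappa ||w1 - w2||_(0, t)] for every [t >= p w1].  This is the
   required modulus, and it also makes [{p <= t}] closed for [||.||_(0, t)]; such
   sets belong to the raw sigma-algebra [F_t] because the path space is
   separable and closed balls are countable intersections over rational times. *)

Import Order.TTheory GRing.Theory Num.Theory.
Import numFieldNormedType.Exports.

Local Open Scope classical_set_scope.
Local Open Scope ring_scope.

(** * The Euclidean norm on row vectors and its comparison with the max norm *)

Section euclidean_norm.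
Context {R : realType} {d : nat}.
Implicit Types x y : 'rV[R]_d.

Lemma euclid_norm_ge0 x : 0 <= euclid_norm x.
Proof. exact: sqrtr_ge0. Qed.

Lemma sqr_euclid_norm x : euclid_norm x ^+ 2 = \sum_(i < d) x 0 i ^+ 2.
Proof. by rewrite sqr_sqrtr// sumr_ge0// => i _; rewrite sqr_ge0. Qed.

Lemma euclid_norm0 : euclid_norm (0 : 'rV[R]_d) = 0.
Proof.
by rewrite /euclid_norm big1 ?sqrtr0// => i _; rewrite mxE expr0n.
Qed.

Lemma euclid_normN x : euclid_norm (- x) = euclid_norm x.
Proof.
by congr Num.sqrt; apply: eq_bigr => i _; rewrite mxE sqrrN.
Qed.

Lemma euclid_distC x y : euclid_norm (x - y) = euclid_norm (y - x).
Proof. by rewrite -euclid_normN opprB. Qed.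

Lemma euclid_norm0_eq0 x : euclid_norm x = 0 -> x = 0.
Proof.
move=> x0; have := sqr_euclid_norm x; rewrite x0 expr0n/= => /esym/eqP.
rewrite psumr_eq0; last by move=> i _; rewrite sqr_ge0.
move=> /allP xi0; apply/matrixP => i j; rewrite ord1 mxE.
by apply/eqP; have := xi0 j (mem_index_enum j); rewrite sqrf_eq0.
Qed.

(** With [a] and [b] the two norms, expanding the sum of the squares [(b x_i - a y_i)^2] gives [2ab]
    times the claim; vanishing norms are treated first so that [a * b] can be cancelled. *)
Lemma euclid_cauchy_schwarz x y :
  \sum_(i < d) x 0 i * y 0 i <= euclid_norm x * euclid_norm y.
Proof.
have [x0|x0] := eqVneq (euclid_norm x) 0.
  by rewrite x0 (euclid_norm0_eq0 _ x0) mul0r big1// => i _; rewrite mxE mul0r.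
have [y0|y0] := eqVneq (euclid_norm y) 0.
  by rewrite y0 (euclid_norm0_eq0 _ y0) mulr0 big1// => i _; rewrite mxE mulr0.
set a := euclid_norm x in x0 *; set b := euclid_norm y in y0 *.
have ab_gt0 : 0 < a * b.
  by rewrite mulr_gt0// lt_def ?x0 ?y0/= euclid_norm_ge0.
have : 0 <= \sum_(i < d) (b * x 0 i - a * y 0 i) ^+ 2.
  by rewrite sumr_ge0// => i _; rewrite sqr_ge0.
have -> : \sum_(i < d) (b * x 0 i - a * y 0 i) ^+ 2 =
    b ^+ 2 * \sum_(i < d) x 0 i ^+ 2 + a ^+ 2 * \sum_(i < d) y 0 i ^+ 2 -
    2 * (a * b) * \sum_(i < d) x 0 i * y 0 i.
  rewrite !mulr_sumr -big_split/= -sumrB; apply: eq_bigr => i _; ring.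
rewrite -!sqr_euclid_norm -/a -/b => h.
rewrite -(ler_pM2l ab_gt0); nra.
Qed.

Lemma euclid_normD x y : euclid_norm (x + y) <= euclid_norm x + euclid_norm y.
Proof.
rewrite -ler_sqr ?nnegrE ?addr_ge0 ?euclid_norm_ge0// sqr_euclid_norm.
have -> : \sum_(i < d) (x + y) 0 i ^+ 2 = \sum_(i < d) x 0 i ^+ 2 +
    \sum_(i < d) y 0 i ^+ 2 + 2 * \sum_(i < d) x 0 i * y 0 i.
  rewrite mulr_sumr -!big_split/=; apply: eq_bigr => i _; rewrite mxE; ring.
rewrite -!sqr_euclid_norm; have := euclid_cauchy_schwarz x y; nra.
Qed.

Lemma euclid_dist_triangle y x z :
  euclid_norm (x - z) <= euclid_norm (x - y) + euclid_norm (y - z).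
Proof.
by have := euclid_normD (x - y) (y - z); rewrite addrA subrK.
Qed.

Lemma euclid_norm_le (c : R) x : 0 <= c ->
  (forall i, `|x 0 i| <= c) -> euclid_norm x <= d%:R * c.
Proof.
move=> c0 xc; have dc0 : 0 <= d%:R * c by rewrite mulr_ge0.
rewrite -[leRHS]ger0_norm// -sqrtr_sqr ler_wsqrtr//.
apply: (@le_trans _ _ (\sum_(i < d) c ^+ 2)).
  by apply: ler_sum => i _; rewrite -real_normK ?num_real// lerXn2r// nnegrE.
rewrite sumr_const card_ord exprMn -[leLHS]mulr_natl ler_wpM2r ?sqr_ge0//.
by case: d => [|n]; rewrite ?expr0n// expr2 ler_peMl// ler1n.
Qed.

(** Dividing by [d.+1] instead of [d] covers [d = 0] and makes the conclusion strict. *)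
Lemma ball_euclid x y (e : R) : 0 < e ->
  ball x (e / d.+1%:R) y -> euclid_norm (x - y) < e.
Proof.
move=> e0 [_ xy]; apply: (@le_lt_trans _ _ (d%:R * (e / d.+1%:R))).
  apply: euclid_norm_le => [|i]; first by rewrite divr_ge0// ltW.
  by rewrite !mxE ltW//; exact: (xy 0 i).
by rewrite mulrA ltr_pdivrMr// mulrC ltr_pM2l// ltr_nat.
Qed.

Lemma open_euclid_gt y (c : R) : open [set x | c < euclid_norm (x - y)].
Proof.
rewrite openE => x /= cx.
have e0 : 0 < euclid_norm (x - y) - c by rewrite subr_gt0.
apply/nbhs_ballP; exists ((euclid_norm (x - y) - c) / d.+1%:R) => /=.
  by rewrite divr_gt0.
move=> z /(ball_euclid _ _ _ e0) /=; have := euclid_dist_triangle z x y; lra.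
Qed.

End euclidean_norm.

(** * Uniform continuity and boundedness of paths, by compactness of [[0, T]] *)

Section continuous_time.
Context {R : realType} {d : nat} {T : R}.
Variable f : time T -> 'rV[R]_d.
Hypothesis cf : continuous f.

Lemma time_bounds (r : time T) : 0 <= \val r <= T.
Proof. by have := set_valP r; rewrite /= in_itv. Qed.

Lemma timeP (x : R) : 0 <= x <= T -> exists r : time T, \val r = x.
Proof.
move=> x0T; have xT : x \in `[0, T]%classic by rewrite inE/= in_itv.
by exists (SigSub xT).
Qed.

Lemma euclid_continuous (r : time T) (e : R) : 0 < e ->
  exists2 h : R, 0 < h & forall s : time T,
    `|\val r - \val s| < h -> euclid_norm (f r - f s) < e.
Proof.
move=> e0; have ed0 : 0 < e / d.+1%:R by rewrite divr_gt0.
have fr : \forall s \near r, ball (f r) (e / d.+1%:R) (f s).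
  exact: ((cvg_ballP _ _).1 (cf r) _ ed0).
have [h /= h0 hf] := (@nbhs_ballP R (time T) _ _).1 fr.
by exists h => // s rs; apply: ball_euclid => //; exact: (hf s).
Qed.

Lemma euclid_unif_continuous (e : R) : 0 < e ->
  exists2 h : R, 0 < h & forall r s : time T,
    `|\val r - \val s| < h -> euclid_norm (f r - f s) < e.
Proof.
move=> e0.
(* Compactness is applied to the segment of [R], so [P] compares two times with a real centre [x];
   the centre is [\val r] in the end. *)
pose P (h x : R) := forall r s : time T, `|\val r - x| < h ->
  `|\val s - x| < h -> euclid_norm (f r - f s) < e.
have : \forall h \near 0^'+, `[0, T]%classic `<=` P h.
  apply: ((compact_near_coveringP _).1 (@segment_compact R 0 T)).
  move=> x /=; rewrite in_itv/= => /timeP[t <-].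
  have e20 : 0 < e / 2 by lra.
  have [h h0 hf] := euclid_continuous t _ e20.
  have h20 : 0 < h / 2 by lra.
  exists (ball (\val t) (h / 2), [set k | k < h / 2]) => /=.
    by split; [exact: nbhsx_ballx|exact: nbhs_right_lt].
  move=> [y k] [/= ty kh] r s rk sk.
  have near_t (q : time T) : `|\val q - y| < k -> `|\val t - \val q| < h.
    move: ty; rewrite /ball/= => ty qk.
    have := ler_distD y (\val t) (\val q); rewrite (distrC y); lra.
  have := hf _ (near_t _ rk); have := hf _ (near_t _ sk).
  have := euclid_dist_triangle (f t) (f r) (f s).
  by rewrite (euclid_distC (f r) (f t)); lra.
move=> hP.
have [h [h0 hPh]] : exists h : R, 0 < h /\ `[0, T]%classic `<=` P h.
  near (0 : R)^'+ => h; exists h; split; first by [].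
  by near: h.
exists h => // r s rs; apply: (hPh (\val r)) => //=.
- by rewrite in_itv/= time_bounds.
- by rewrite subrr normr0.
- by rewrite distrC.
Unshelve. all: by end_near. Qed.

Lemma euclid_bounded : exists M : R, forall r, euclid_norm (f r) <= M.
Proof.
have : \forall M \near +oo, `[0, T]%classic `<=`
    (fun x => forall r : time T, \val r = x -> euclid_norm (f r) <= M).
  apply: ((compact_near_coveringP _).1 (@segment_compact R 0 T)).
  move=> x /=; rewrite in_itv/= => /timeP[t <-].
  have [h h0 hf] := euclid_continuous t _ ltr01.
  exists (ball (\val t) h, [set M | euclid_norm (f t) + 1 < M]) => /=.
    by split; [exact: nbhsx_ballx|apply: nbhs_pinfty_gt; rewrite num_real].
  move=> [y M] [/= ty tM] r ry; move: ty; rewrite -ry => /hf.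
  have := euclid_normD (f r - f t) (f t); rewrite subrK euclid_distC; lra.
move=> hM; near +oo_R => M; exists M => r.
have : `[0, T]%classic `<=`
    (fun x => forall r : time T, \val r = x -> euclid_norm (f r) <= M).
  by near: M.
by move=> /(_ (\val r)); apply => //=; rewrite in_itv/= time_bounds.
Unshelve. all: by end_near. Qed.

(** A [sup] dominates its set only if the set is bounded above, which [euclid_bounded] ensures. *)
Lemma euclid_le_sup_norm (t : R) (r : time T) : \val r <= t ->
  euclid_norm (f r) <= sup_norm f t.
Proof.
move=> rt; apply: ub_le_sup; last by exists r.
by have [M fM] := euclid_bounded; exists M => _ [s _ <-].
Qed.

End continuous_time.

(* [0 <= c] covers [t < 0], where the supremum is that of the empty set. *)
Lemma sup_norm_le (R : realType) (d : nat) (T t c : R)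
    (f : time T -> 'rV[R]_d) : 0 <= c ->
  (forall r : time T, \val r <= t -> euclid_norm (f r) <= c) ->
  sup_norm f t <= c.
Proof.
move=> c0 fc; rewrite /sup_norm; set S := image _ _.
have [->|/set0P S0] := eqVneq S set0; first by rewrite sup0.
by apply: ge_sup => // _ [r rt <-]; exact: fc.
Qed.

(** * The pseudometrics [path_dist] and their dependence on time *)

Section path_distance.
Context {R : realType} {d : nat} {T : R}.
Implicit Types (w v : path_space d T) (t c : R).

Lemma path_sub_continuous w v : continuous (fun r => w r - v r).
Proof.
move=> r; have cw := @path_continuous _ _ _ w r.
have cv := @path_continuous _ _ _ v r.
exact: (cvgB cw cv).
Qed.

Lemma path_dist_ub w v t (r : time T) : \val r <= t ->
  euclid_norm (w r - v r) <= path_dist w v t.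
Proof. exact: (euclid_le_sup_norm _ (path_sub_continuous w v)). Qed.

Lemma path_dist_ge0 w v t : 0 <= path_dist w v t.
Proof.
rewrite /path_dist /sup_norm; set S := image _ _.
have [->|/set0P[_ [r rt _]]] := eqVneq S set0; first by rewrite sup0.
exact: le_trans (euclid_norm_ge0 _) (path_dist_ub _ _ _ _ rt).
Qed.

Lemma path_distxx w t : path_dist w w t = 0.
Proof.
apply/eqP; rewrite eq_le path_dist_ge0 andbT.
by apply: sup_norm_le => // r _; rewrite subrr euclid_norm0.
Qed.

Lemma path_distC w v t : path_dist w v t = path_dist v w t.
Proof.
by apply/eqP; rewrite eq_le; apply/andP; split; apply: sup_norm_le => [|r rt];
  rewrite ?path_dist_ge0// euclid_distC path_dist_ub.
Qed.

Lemma path_dist_triangle u w v t :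
  path_dist w v t <= path_dist w u t + path_dist u v t.
Proof.
apply: sup_norm_le => [|r rt]; first by rewrite addr_ge0 ?path_dist_ge0.
by rewrite (le_trans (euclid_dist_triangle (u r) _ _))// lerD// path_dist_ub.
Qed.

Lemma path_dist_homo w v : {homo path_dist w v : s t / s <= t}.
Proof.
move=> s t st; apply: sup_norm_le => [|r rs]; first exact: path_dist_ge0.
exact/path_dist_ub/(le_trans rs).
Qed.

Lemma path_dist_right_continuous w v t (e : R) : 0 <= t <= T -> 0 < e ->
  exists2 s, t < s & path_dist w v s <= path_dist w v t + e.
Proof.
move=> /timeP[r <-] e0.
have [h h0 hr] := euclid_continuous _ (path_sub_continuous w v) r _ e0.
(* This time may exceed [T], where the supremum simply ranges over all of [[0, T]]. *)
exists (\val r + h / 2); first by lra.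
apply: sup_norm_le => [|s sh]; first by rewrite addr_ge0 ?path_dist_ge0// ltW.
have [sr|rs] := leP (\val s) (\val r).
  by have := path_dist_ub w v _ _ sr; lra.
have /hr : `|\val r - \val s| < h by rewrite ler0_norm; lra.
have := path_dist_ub w v _ _ (lexx (\val r)).
have := euclid_normD (w s - v s - (w r - v r)) (w r - v r).
rewrite subrK (euclid_distC (w s - v s)) /=; lra.
Qed.

End path_distance.

(** * Separability of sets of paths in the uniform distance *)

(** One representative is chosen in each nonempty fibre of [key] over [A]; [key] is injective on the
    representatives. In the proof, [None] marks an empty fibre. *)
Lemma countable_selection (X : Type) (K : countType) (key : X -> K)
    (A : set X) : exists V : set X, [/\ countable V, V `<=` A &
  forall w, A w -> exists2 v, V v & key v = key w].
Proof.
have /choice[g gP] : forall k, exists o : option X,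
    if o is Some v then A v /\ key v = k else forall v, A v -> key v <> k.
  move=> k; have [[v Av vk]|nk] := pselect (exists2 v, A v & key v = k).
    by exists (Some v).
  by exists None => v Av vk; apply: nk; exists v.
exists [set v | exists k, g k = Some v]; split.
- apply/countable_injP; exists (pickle \o key) => v w.
  rewrite !inE/= => -[k gk] [l gl] /(pcan_inj pickleK) vw.
  have := gP k; have := gP l; rewrite gk gl => -[_ wl] [_ vk].
  by move: gk; rewrite -vk vw wl gl => -[].
- by move=> v /= [k gk]; have := gP k; rewrite gk => -[].
- move=> w Aw; case gw: (g (key w)) (gP (key w)) => [v|].
    by move=> [Av vw]; exists v => //; exists (key w).
  by move=> /(_ w Aw).
Qed.

Section separability.
Context {R : realType} {d : nat} {T : R}.
Hypothesis T_gt0 : 0 < T.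

(* Instead of building an explicit countable dense set, choose in [A] one path
   for each modulus of continuity and each rounding of the values on a grid:
   this yields a dense set inside an arbitrary [A]. *)
Lemma path_separable (A : set (path_space d T)) :
  exists V : set (path_space d T), [/\ countable V, V `<=` A &
    forall w (e : R), A w -> 0 < e ->
      exists2 v, V v & forall t, path_dist w v t <= e].
Proof.
have /choice[g gE] : forall x, exists r : time T, 0 <= x <= T -> \val r = x.
  move=> x; have [/timeP[r rx]|_] := boolP (0 <= x <= T); first by exists r.
  have T0 : (0 : R) <= 0 <= T by rewrite lexx ltW.
  have [r _] := timeP _ T0.
  by exists r.
(* The mesh is [T / N.+1]; the [N.+2] rows of [key] include both endpoints, and [r = T] below does
   give the index [N.+1]. *)
pose grid N (i : nat) := g (T * (i%:R / N.+1%:R)).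
pose key n N (w : path_space d T) : 'M[int]_(N.+2, d) :=
  \matrix_(i, j) Num.floor (n.+1%:R * w (grid N i) 0 j).
pose tame n N := [set w : path_space d T | forall r s : time T,
  `|\val r - \val s| <= T / N.+1%:R -> euclid_norm (w r - w s) <= n.+1%:R^-1].
have /choice[V VP] : forall nN : nat * nat, exists V, [/\ countable V,
    V `<=` A `&` tame nN.1 nN.2 & forall w, (A `&` tame nN.1 nN.2) w ->
    exists2 v, V v & key nN.1 nN.2 v = key nN.1 nN.2 w].
  by move=> [n N]; exact: countable_selection.
exists (\bigcup_nN V nN); split.
- by apply: bigcup_countable => // nN _; have [] := VP nN.
- by move=> v [nN _ Vv]; have [_ VA _] := VP nN; have [] := VA _ Vv.
move=> w e Aw e0.
(* Error budget in units of [1 / n.+1]: [d] for the rounding at a grid point, and one for the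
   oscillation of each of [w] and [v] between that point and [r]. *)
pose n := Num.truncn (d.+2%:R / e).
have n_gt : d.+2%:R * n.+1%:R^-1 <= e.
  rewrite ler_pdivrMr// mulrC -ler_pdivrMr//.
  by have /andP[_ /ltW] := truncn_itv (ltW (divr_gt0 (ltr0Sn R d.+1) e0)).
have in0 : 0 < (n.+1%:R : R)^-1 by rewrite invr_gt0.
have [h h0 hw] := euclid_unif_continuous _ (@path_continuous _ _ _ w) _ in0.
pose N := Num.truncn (T / h).
have N_gt : T / N.+1%:R < h.
  rewrite ltr_pdivrMr// mulrC -ltr_pdivrMr//.
  by have /andP[] := truncn_itv (ltW (divr_gt0 T_gt0 h0)).
have tw : tame n N w by move=> r s rs; apply/ltW/hw/(le_lt_trans rs).
have [_ VA /(_ w (conj Aw tw))[v Vv vw]] := VP (n, N).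
have [_ tv] : (A `&` tame n N) v := VA _ Vv.
exists v; first by exists (n, N).
move=> t; apply: sup_norm_le => [|r _]; first exact: ltW.
have /andP[r0 rT] := time_bounds r.
have rN0 : 0 <= \val r * N.+1%:R / T by rewrite divr_ge0 ?mulr_ge0// ltW.
pose i := Num.truncn (\val r * N.+1%:R / T).
have /andP[ir ri] : i%:R <= \val r * N.+1%:R / T < i.+1%:R := truncn_itv rN0.
have ilt : (i < N.+2)%N.
  rewrite ltnS -(ler_nat R) (le_trans ir)// ler_pdivrMr// mulrC ler_wpM2l//.
have N0 : 0 < N.+1%:R :> R by [].
have gr : T * (i%:R / N.+1%:R) <= \val r.
  by rewrite mulrA ler_pdivrMr// mulrC -ler_pdivlMr.
have gr' : \val r <= T * (i%:R / N.+1%:R) + T / N.+1%:R.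
  by move: ri; rewrite mulrA -mulrDl ler_pdivlMr// ltr_pdivrMr// -natr1; lra.
have gE' : \val (grid N i) = T * (i%:R / N.+1%:R).
  by apply: gE; rewrite (le_trans gr rT) andbT mulr_ge0 ?divr_ge0// ltW.
have rg : `|\val r - \val (grid N i)| <= T / N.+1%:R.
  by rewrite gE' ger0_norm ?subr_ge0// lerBlDl.
have dg : euclid_norm (w (grid N i) - v (grid N i)) <= d%:R * n.+1%:R^-1.
  (* Equal floors of [n.+1 * x] and [n.+1 * y] put [x] and [y] within [1 / n.+1] of each other. *)
  apply: euclid_norm_le => [|j]; first exact: ltW.
  have := congr1 (fun M : 'M[int]_(N.+2, d) => M (Ordinal ilt) j) vw.
  rewrite !mxE/=.
  set x := w _ 0 j; set y := v _ 0 j => xy.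
  have := floor_itv (n.+1%:R * x); have := floor_itv (n.+1%:R * y).
  rewrite xy intrD => /andP[y1 y2] /andP[x1 x2].
  rewrite -[leRHS]mul1r ler_pdivlMr// -[X in _ * X]ger0_norm// -normrM mulrC.
  rewrite mulrBr ler_distl; apply/andP; split; lra.
have := tv _ _ rg; have := tw _ _ rg.
have := euclid_dist_triangle (w (grid N i)) (w r) (v r).
have := euclid_dist_triangle (v (grid N i)) (w (grid N i)) (v r).
rewrite (euclid_distC (v (grid N i)) (v r)).
move: n_gt dg; rewrite -addn2 natrD mulrDl.
move: (n.+1%:R^-1) (_ * _) => k dk; lra.
Qed.

End separability.

(** * Events of the raw filtration: balls and closed sets *)

Lemma sigma_algebra_bigcup_countable {X I : Type} {G : set (set X)}
    {D : set I} {F : I -> set X} : countable D ->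
  (forall i, D i -> <<s G >> (F i)) -> <<s G >> (\bigcup_(i in D) F i).
Proof.
move=> cD GF; have [sigma0 _ sigmaU] := smallest_sigma_algebra setT G.
have [->|[f]] := pfcard_geP cD; first by rewrite bigcup_set0.
have -> : \bigcup_(i in D) F i = \bigcup_n F (f n).
  apply/seteqP; split => [x [i /(@surj _ _ _ _ f)[n _ <-] Fx]|x [n _ Fx]].
    by exists n.
  by exists (f n) => //; exact: funS.
by apply: sigmaU => n; apply: GF; exact: funS.
Qed.

Lemma sigma_algebra_bigcap_countable {X I : Type} {G : set (set X)}
    {D : set I} {F : I -> set X} : countable D ->
  (forall i, D i -> <<s G >> (F i)) -> <<s G >> (\bigcap_(i in D) F i).
Proof.
move=> cD GF; have [_ sigmaC _] := smallest_sigma_algebra setT G.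
have -> : \bigcap_(i in D) F i = setT `\` \bigcup_(i in D) (setT `\` F i).
  by rewrite setTD setC_bigcup; apply: eq_bigcapr => i _; rewrite setTD setCK.
apply: (sigmaC _); apply: sigma_algebra_bigcup_countable => // i Di.
by apply: sigmaC; exact: GF.
Qed.

Section closed_events.
Context {R : realType} {d : nat} {T : R}.

(** The complement is the preimage of an open set under the canonical process at time [r], hence a
    generator. *)
Lemma natural_filtration_marginal_ball (v : path_space d T) (t c : R)
    (r : time T) : \val r <= t ->
  natural_filtration t [set w : path_space d T | euclid_norm (w r - v r) <= c].
Proof.
move=> rt; set A := [set w | _].
have -> : A = setT `\` [set w : path_space d T | c < euclid_norm (w r - v r)].
  rewrite setTD; apply/seteqP; split => w; rewrite /A/=.
    by rewrite leNgt => /negP.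
  by move=> /negP; rewrite -leNgt.
have [_ sigmaC _] := smallest_sigma_algebra setT
  (\bigcup_(r in [set r : time T | \val r <= t])
        preimage_set_system setT (@canonical_process R d T r)
          <<s (open : set (set 'rV[R]_d)) >>).
apply: sigmaC; apply: sub_sigma_algebra; exists r => //.
exists [set x | c < euclid_norm (x - v r)]; last by rewrite setTI.
by apply: sub_sigma_algebra; exact: open_euclid_gt.
Qed.

Lemma natural_filtration_path_ball (v : path_space d T) (t c : R) : 0 <= c ->
  natural_filtration t [set w | path_dist w v t <= c].
Proof.
move=> c0.
(* Rational multiples of [t] form a countable dense set of the times up to [t]; by continuity they
   determine the supremum. *)
pose Q := [set r : time T | \val r <= t /\ exists q, \val r = t * ratr q].
have -> : [set w | path_dist w v t <= c] = \bigcap_(r in Q)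
    [set w : path_space d T | euclid_norm (w r - v r) <= c].
  apply/seteqP; split => w /=.
    by move=> wv r [rt _]; exact: le_trans (path_dist_ub _ _ _ _ rt) wv.
  move=> wQ; apply: sup_norm_le => // r rt; apply/ler_addgt0Pr => e e0.
  have [h h0 hr] := euclid_continuous _ (path_sub_continuous w v) r _ e0.
  suff [s Qs /hr] : exists2 s, Q s & `|\val r - \val s| < h.
    have := wQ _ Qs; have := euclid_normD (w r - v r - (w s - v s)) (w s - v s).
    by rewrite subrK/=; lra.
  have /andP[r0 rT] := time_bounds r.
  (* A positive time is approximated from the left, which keeps [s] below [t]; time [0] belongs to
     [Q] itself. *)
  have [rE|rn0] := eqVneq (\val r) 0.
    exists r; last by rewrite subrr normr0.
    by split => //; exists 0; rewrite rmorph0 mulr0.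
  have rgt0 : 0 < \val r by rewrite lt_def rn0.
  have t0 : 0 < t by rewrite (lt_le_trans rgt0).
  have : Num.max 0 (\val r - h) / t < \val r / t.
    by rewrite ltr_pM2r ?invr_gt0// gt_max rgt0; lra.
  move=> /rat_in_itvoo[q]; rewrite in_itv/= ltr_pdivrMr// ltr_pdivlMr//.
  rewrite (mulrC (ratr q)) gt_max => /andP[/andP[q0 qh] qr].
  have /timeP[s sE] : 0 <= t * ratr q <= T.
    by rewrite (ltW q0) (le_trans (ltW qr)).
  exists s; first by split; [rewrite sE (le_trans (ltW qr))|exists q].
  by rewrite sE ger0_norm ?subr_ge0 ?(ltW qr)// ltrBlDl -ltrBlDr.
apply: sigma_algebra_bigcap_countable => [|r [rt _]]; last first.
  exact: natural_filtration_marginal_ball.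
have /choice[k kP] : forall r : time T, exists q, Q r -> \val r = t * ratr q.
  by move=> r; have [[_ [q rq]]|] := pselect (Q r); [exists q|exists 0].
apply/countable_injP; exists (pickle \o k) => r s; rewrite !inE.
move=> Qr Qs /(pcan_inj pickleK) rs.
by apply: val_inj; rewrite (kP _ Qr) rs -(kP _ Qs).
Qed.

(** With [V] countable and dense in [A], the set [A] is the intersection over [n] of the unions of
    balls of radius [1 / n.+1] around [V]. The centres must lie in [A], so that closedness gives the
    reverse inclusion. *)
Lemma natural_filtration_closed (t : R) (A : set (path_space d T)) : 0 < T ->
  (forall w, (forall e : R, 0 < e -> exists2 v, A v & path_dist w v t <= e) ->
    A w) ->
  natural_filtration t A.
Proof.
move=> T0 clA; have [V [cV VA Vdense]] := path_separable T0 A.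
have -> : A = \bigcap_(n : nat)
    \bigcup_(v in V) [set w | path_dist w v t <= n.+1%:R^-1].
  apply/seteqP; split => w.
    move=> Aw n _; have n0 : 0 < n.+1%:R^-1 :> R by rewrite invr_gt0.
    by have [v Vv wv] := Vdense w _ Aw n0; exists v => //; exact: wv.
  move=> wV; apply: clA => e e0; pose n := Num.truncn e^-1.
  have [v Vv wv] := wV n I; exists v; first exact: VA.
  rewrite (le_trans wv)// -[leRHS]invrK lef_pV2 ?posrE ?invr_gt0//.
  have ei0 : 0 <= e^-1 by rewrite invr_ge0 ltW.
  by have /andP[_ /ltW] := truncn_itv ei0.
apply: sigma_algebra_bigcap_countable => // n _.
apply: sigma_algebra_bigcup_countable => // v _.
exact: natural_filtration_path_ball.
Qed.

End closed_events.

(** * The infimum [p], its modulus of continuity and the stopping property *)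

Theorem lemmaA6 (R : realType) (d : nat) (T : R) (T_gt0 : 0 < T)
    (theta1 theta2 theta3 : path_space d T -> R)
    (theta1_rv : path_random_variable theta1)
    (theta2_rv : path_random_variable theta2)
    (theta3_rv : path_random_variable theta3)
    (delta : R) (delta_gt0 : 0 < delta)
    (theta12 : forall w w' : path_space d T,
       closed_tube delta (theta2 w) w w' -> theta1 w' <= theta2 w)
    (theta23 : forall w w' : path_space d T,
       closed_tube delta (theta3 w) w w' -> theta2 w' <= theta3 w)
    (theta2_bnd : forall w : path_space d T, 0 < theta2 w <= T)
    (kappa : R) (kappa_gt : T / delta < kappa) :
  exists p : path_space d T -> R,
    [/\ stopping_time p,
        forall w : path_space d T, theta1 w <= p w <= theta3 w &
        forall w1 w2 : path_space d T,
          let a := Num.min (p w1) (p w2) in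
          let b := Num.max (p w1) (p w2) in
          forall t0 : R,
            b <= t0 <= T \/
            a <= t0 < b /\ a + kappa * path_dist w1 w2 t0 <= t0 ->
            `|p w1 - p w2| <= kappa * path_dist w1 w2 t0].
Proof.
have kappa_gt0 : 0 < kappa by rewrite (le_lt_trans _ kappa_gt)// divr_ge0// ltW.
have kappa_delta : T < kappa * delta by rewrite -ltr_pdivrMr.
have tube_refl (w : path_space d T) t : closed_tube delta t w w.
  by rewrite /closed_tube/= path_distxx ltW.
pose f v w := Num.min T (theta2 v + kappa * path_dist w v (theta2 v)).
pose p w := inf [set f v w | v in setT].
have theta2_le v w : theta2 v <= f v w.
  have /andP[_ vT] := theta2_bnd v.
  by rewrite le_min vT lerDl mulr_ge0 ?path_dist_ge0// ltW.
have f_nonempty w : [set f v w | v in setT] !=set0 by exists (f w w), w.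
have f_ge0 v w : 0 <= f v w.
  by have /andP[/ltW v0 _] := theta2_bnd v; exact: le_trans (theta2_le v w).
have p_le v w : p w <= f v w.
  by apply: ge_inf; [exists 0 => _ [u _ <-]|exists v].
have le_p c w : (forall v, c <= f v w) -> c <= p w.
  by move=> cf; apply: lb_le_inf => // _ [v _ <-].
have p_bnd w : 0 <= p w <= T.
  by rewrite le_p// (le_trans (p_le w w))// ge_min lexx.
have modulus w1 w2 (t0 : R) : p w1 <= t0 ->
    p w2 <= p w1 + kappa * path_dist w1 w2 t0.
  move=> pt0.
  suff : p w2 <= p w1 + kappa * path_dist w1 w2 (p w1).
    by move=> /le_trans; apply; rewrite lerD2l ler_pM2l// path_dist_homo.
  apply/ler_addgt0Pr => e e0.
  (* Half of [e] pays for the near-optimality of [v]; the other half, divided by [kappa], bounds the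
     growth of the distance just after [p w1]. *)
  have e2 : 0 < e / 2 by rewrite divr_gt0.
  have ek0 : 0 < e / 2 / kappa by rewrite divr_gt0.
  have [s ps] := path_dist_right_continuous w1 w2 _ _ (p_bnd w1) ek0.
  rewrite -(ler_pM2l kappa_gt0) mulrDr (mulrC kappa (_ / _)) divfK ?gt_eqF//.
  move=> sD.
  (* The bound by [s] forces [theta2 v <= s], so [f v] compares [w1] and [w2] only up to [s]; the
     other bound is near-optimality. *)
  have [|_ [v _ <-]] := @inf_lt _ _ (Num.min s (p w1 + e / 2)) (f_nonempty w1).
    by rewrite -/(p w1) lt_min ps ltrDl.
  rewrite lt_min => /andP[fs fe].
  have vs : theta2 v <= s := le_trans (theta2_le v w1) (ltW fs).
  have ff : f v w2 <= f v w1 + kappa * path_dist w1 w2 s.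
    have D0 : 0 <= kappa * path_dist w1 w2 s.
      by rewrite mulr_ge0 ?path_dist_ge0// ltW.
    rewrite /f addr_minl le_min !ge_min lerDl D0/=.
    apply/orP; right; rewrite -addrA lerD2l -mulrDr ler_pM2l// addrC.
    rewrite (le_trans (path_dist_triangle w1 _ _ _))// lerD2r path_distC.
    exact: path_dist_homo.
  have := p_le v w2; lra.
have theta1_le v w : theta1 w <= f v w.
  have [|far] := leP (path_dist w v (theta2 v)) delta.
    by move=> /(theta12 v w)/le_trans; apply.
  have /andP[_ wT] := theta2_bnd w; have /andP[v0 _] := theta2_bnd v.
  have wle := theta12 _ _ (tube_refl w (theta2 w)).
  rewrite le_min (le_trans wle wT)/=.
  have : kappa * delta < kappa * path_dist w v (theta2 v) by rewrite ltr_pM2l.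
  lra.
exists p; split.
(* An approximating [v] has [p v <= t], so the modulus may be started from [v] at time [t]; a
   distance of at most [e / kappa] then yields [p w <= t + e]. *)
- split => // t /andP[t0 tT]; apply: natural_filtration_closed => // w wA /=.
  apply/ler_addgt0Pr => e e0.
  have [v /= vt] := wA (e / kappa) (divr_gt0 e0 kappa_gt0).
  rewrite ler_pdivlMr// mulrC path_distC => wv.
  by rewrite (le_trans (modulus _ w _ vt))// lerD.
- move=> w; rewrite le_p//= (le_trans (p_le w w))//.
  rewrite ge_min path_distxx mulr0 addr0; apply/orP; right.
  exact: theta23 (tube_refl _ _).
- move=> w1 w2 a b t0 ht0.
  (* Both alternatives give [a <= t0], so the modulus applies from the path with the smaller value
     of [p] and bounds the larger value. *)
  have at0 : a <= t0.
    case: ht0 => [/andP[bt0 _]|[/andP[at0 _] _]]; last exact: at0.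
    by apply: le_trans bt0; rewrite le_max ge_min lexx.
  rewrite ler_distl; move: at0; rewrite /a ge_min.
  have := modulus w1 w2 t0; have := modulus w2 w1 t0; rewrite path_distC.
  have := mulr_ge0 (ltW kappa_gt0) (path_dist_ge0 w1 w2 t0).
  have [p12|/ltW p21] := leP (p w1) (p w2) => k0 m21 m12 /orP[h|h].
  + by have := m12 h; lra.
  + by have := m12 (le_trans p12 h); lra.
  + by have := m21 (le_trans p21 h); lra.
  + by have := m21 h; lra.
Qed.
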